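(* (Dilation covariance.) Let $n\equiv 2$ or $3\pmod 4$, let $\psi\in L^2(\mathbb{R}^n;Cl_n)$ be an admissible Clifford mother wavelet, let $f\in L^2(\mathbb{R}^n;Cl_n)$ and let $c>0$ be real. Then for all $a>0$, $r_\theta\in SO(n)$, $b\in\mathbb{R}^n$, $$[T_\psi f(c\,\cdot)](a,\theta,b)=\frac{1}{c^{n/2}}\,T_\psi f(ca,\theta,cb) ,$$ where the left side is the Clifford wavelet transform of the function $x\mapsto f(cx)$.
   Context: $Cl_n=Cl_{n,0}$ is the real Clifford algebra of Euclidean $\mathbb{R}^n$ with orthonormal vectors $e_1,\dots,e_n$ and basis blades $e_A$; $M=\sum_AM_Ae_A$, $|M|^2=\sum_AM_A^2$. The reverse is $\widetilde M=\sum_k(-1)^{k(k-1)/2}\langle M\rangle_k$ (also written $\{M\}^\sim$), $\langle M\rangle_k$ being the grade-$k$ part. $L^2(\mathbb{R}^n;Cl_n)$ is the space of $f:\mathbb{R}^n\to Cl_n$ with $\int|f|^2<\infty$. $i_n=e_1\cdots e_n$, $i_n^2=-1$ for $n\equiv 2,3\pmod 4$. Clifford Fourier transform: $\widehat f(\omega)=\int_{\mathbb{R}^n}f(x)e^{-i_n\omega\cdot x}d^nx$ (extended to $L^2$). Daughter wavelets, for $a>0$, $r_\theta\in SO(n)$ (parametrized by $\theta$), $b\in\mathbb{R}^n$: $\psi_{a,\theta,b}(x)=a^{-n/2}\psi\bigl(r_\theta^{-1}((x-b)/a)\bigr)$. Admissibility: $\psi\in L^2(\mathbb{R}^n;Cl_n)$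 is admissible if $C_\psi=\int_{\mathbb{R}^+}\int_{SO(n)}a^n\{\widehat\psi(a r_\theta^{-1}(\omega))\}^{\sim}\,\widehat\psi(a r_\theta^{-1}(\omega))\,a^{-(n+1)}da\,d\theta$ ($d\theta$ the normalized Haar measure on $SO(n)$) is, for a.e. $\omega$, a finite invertible multivector constant. In addition, for $n\equiv2\pmod4$, $\psi$ is required to have only even-grade or only odd-grade values. Clifford wavelet transform: $T_\psi f(a,\theta,b)=\int_{\mathbb{R}^n}f(x)\widetilde{\psi_{a,\theta,b}(x)}\,d^nx$. *)

(* Defs.v *)
From HB Require Import structures.
From mathcomp Require Import all_boot all_order all_algebra.
From mathcomp Require Import ring.
From mathcomp Require Import all_classical all_reals all_analysis.

Set Implicit Arguments.
Unset Strict Implicit.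
Unset Printing Implicit Defensive.

Import Order.TTheory GRing.Theory Num.Theory.
Import numFieldNormedType.Exports.

Local Open Scope classical_set_scope.
Local Open Scope ring_scope.

(* A multivector of Cl_{n,0} is the family of its coordinates in the basis
   blades e_A = e_{a_1} ... e_{a_k}, A = {a_1 < ... < a_k}, with indices
   starting at 0. *)

Section Sign.
Variables (R : pzRingType) (n : nat).
Implicit Types A B C : {set 'I_n}.

Definition symdiff A B : {set 'I_n} := [set i | (i \in A) (+) (i \in B)]%SET.

(* Moving the factors of e_B into place in e_A e_B costs one transposition for
   each pair i \in A, j \in B with j < i; since e_i ^+ 2 = 1 the repeated
   factors then cancel, so that e_A e_B = blade_sign A B *: e_(symdiff A B). *)
Definition blade_sign A B : R :=
  \prod_(i in A) \prod_(j in B) (-1) ^+ (j < i)%N.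

Lemma symdiffA : associative symdiff.
Proof. by move=> A B C; apply/setP => i; rewrite !inE addbA. Qed.

Lemma symdiffC : commutative symdiff.
Proof. by move=> A B; apply/setP => i; rewrite !inE addbC. Qed.

Lemma symdiff0 A : symdiff A finset.set0 = A.
Proof. by apply/setP => i; rewrite !inE addbF. Qed.

Lemma symdiffK A B : symdiff A (symdiff A B) = B.
Proof. by apply/setP => i; rewrite !inE addKb. Qed.

Lemma symdiff_eq A B C : (symdiff A B == C) = (B == symdiff A C).
Proof. by apply/eqP/eqP => [<-|->]; rewrite symdiffK. Qed.

End Sign.

Section SignTheory.
Variables (R : comPzRingType) (n : nat).
Implicit Types A B C : {set 'I_n}.

Let prod_symdiff (F : 'I_n -> R) A B : (forall i, F i * F i = 1) ->
  \prod_(i in symdiff A B) F i = \prod_(i in A) F i * \prod_(i in B) F i.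
Proof.
move=> FF; rewrite big_mkcond [in RHS]big_mkcond [X in _ * X]big_mkcond.
rewrite -big_split; apply: eq_bigr => i _; rewrite inE.
by case: (i \in A); case: (i \in B) => /=; rewrite ?mulr1 ?mul1r ?FF.
Qed.

Let sign_sqr (b : bool) : (-1) ^+ b * (-1) ^+ b = 1 :> R.
Proof. by rewrite -signr_addb addbb. Qed.

Lemma blade_signDl A B C :
  blade_sign R (symdiff A B) C = blade_sign R A C * blade_sign R B C.
Proof.
apply: prod_symdiff => i; rewrite -big_split big1 // => j _; exact: sign_sqr.
Qed.

Lemma blade_signDr A B C :
  blade_sign R A (symdiff B C) = blade_sign R A B * blade_sign R A C.
Proof.
rewrite -big_split; apply: eq_bigr => i _; apply: prod_symdiff => j.
exact: sign_sqr.
Qed.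

Lemma blade_sign0l A : blade_sign R finset.set0 A = 1.
Proof. by rewrite /blade_sign big_set0. Qed.

Lemma blade_sign0r A : blade_sign R A finset.set0 = 1.
Proof. by rewrite /blade_sign big1 // => i _; rewrite big_set0. Qed.

End SignTheory.

Definition clifford (R : Type) (n : nat) : Type := {ffun {set 'I_n} -> R}.

HB.instance Definition _ (R : comNzRingType) n :=
  GRing.Lmodule.copy (clifford R n) {ffun {set 'I_n} -> R^o}.

Section Clifford.
Variables (R : comNzRingType) (n : nat).
Implicit Types (A B C : {set 'I_n}) (M N P : clifford R n).

Definition blade A : clifford R n := [ffun B => (A == B)%:R].

Definition clmul M N : clifford R n :=
  [ffun C => \sum_A \sum_(B | symdiff A B == C) blade_sign R A B * M A * N B].

Lemma clmulE M N C : clmul M N C =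
  \sum_A blade_sign R A (symdiff A C) * M A * N (symdiff A C).
Proof.
rewrite ffunE; apply: eq_bigr => A _; rewrite (big_pred1 (symdiff A C)) // => B.
exact: symdiff_eq.
Qed.

Let clmulA : associative clmul.
Proof.
move=> M N P; apply/ffunP => D; rewrite !clmulE.
under eq_bigr => A _ do rewrite clmulE mulr_sumr.
under [RHS]eq_bigr => E _ do rewrite clmulE mulr_sumr mulr_suml.
rewrite [RHS]exchange_big; apply: eq_bigr => A _ /=.
rewrite [RHS](reindex_inj (can_inj (symdiffK A))); apply: eq_bigr => B _ /=.
rewrite symdiffK; set Y := symdiff B (symdiff A D).
have -> : symdiff A D = symdiff B Y by rewrite symdiffK.
have -> : symdiff (symdiff A B) D = Y.
  by rewrite /Y (symdiffC A B) -symdiffA.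
rewrite blade_signDl blade_signDr.
ring.
Qed.

Let clmul1l : left_id (blade finset.set0) clmul.
Proof.
move=> M; apply/ffunP => D; rewrite clmulE (bigD1 finset.set0) //= big1 => [|A].
  by rewrite symdiffC symdiff0 ffunE eqxx blade_sign0l !mul1r addr0.
by move=> A0; rewrite ffunE eq_sym (negbTE A0) mulr0 mul0r.
Qed.

Let clmul1r : right_id (blade finset.set0) clmul.
Proof.
move=> M; apply/ffunP => D; rewrite clmulE (bigD1 D) //= big1 => [|A].
  have -> : symdiff D D = finset.set0 by rewrite -[D in symdiff _ D]symdiff0 symdiffK.
  by rewrite ffunE eqxx blade_sign0r mul1r mulr1 addr0.
move=> AD; rewrite ffunE [_ == _](_ : _ = false) ?mulr0 //.
by rewrite eq_sym symdiff_eq symdiff0 eq_sym (negbTE AD).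
Qed.

Let clmulDl : left_distributive clmul +%R.
Proof.
move=> M N P; apply/ffunP => D; rewrite [in RHS]ffunE !clmulE -big_split /=.
by apply: eq_bigr => A _; rewrite ffunE mulrDr mulrDl.
Qed.

Let clmulDr : right_distributive clmul +%R.
Proof.
move=> M N P; apply/ffunP => D; rewrite [in RHS]ffunE !clmulE -big_split /=.
by apply: eq_bigr => A _; rewrite ffunE mulrDr.
Qed.

Let clone_neq0 : blade finset.set0 != 0.
Proof.
apply/eqP => /ffunP/(_ finset.set0); rewrite !ffunE eqxx => /eqP.
by rewrite oner_eq0.
Qed.

HB.instance Definition _ := GRing.Zmodule_isNzRing.Build (clifford R n)
  clmulA clmul1l clmul1r clmulDl clmulDr clone_neq0.

Let clscaleAl (a : R) M N : a *: (M * N) = (a *: M) * N.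
Proof.
apply/ffunP => D; rewrite ffunE !clmulE scaler_sumr; apply: eq_bigr => A _.
by rewrite ffunE /GRing.scale /= !mulrA [a * _]mulrC.
Qed.

HB.instance Definition _ :=
  GRing.Lmodule_isLalgebra.Build R (clifford R n) clscaleAl.

Let clscaleAr (a : R) M N : a *: (M * N) = M * (a *: N).
Proof.
apply/ffunP => D; rewrite ffunE !clmulE scaler_sumr; apply: eq_bigr => A _.
rewrite ffunE /GRing.scale /=; ring.
Qed.

HB.instance Definition _ :=
  GRing.Lalgebra_isAlgebra.Build R (clifford R n) clscaleAr.

Lemma bladeM A B :
  blade A * blade B = blade_sign R A B *: blade (symdiff A B).
Proof.
apply/ffunP => D; rewrite [LHS]clmulE (bigD1 A) //= big1 => [|A' A'A].
  by rewrite !ffunE eqxx mulr1 addr0 eq_sym symdiff_eq eq_sym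
    /GRing.scale /=; case: eqP => [<-|]; rewrite ?mulr0 // symdiffK.
by rewrite ffunE eq_sym (negbTE A'A) mulr0 mul0r.
Qed.

Definition e_ (i : 'I_n) : clifford R n := blade [set i]%SET.

Lemma e_anticomm (i j : 'I_n) : e_ i * e_ j + e_ j * e_ i = (i == j)%:R *+ 2.
Proof.
rewrite !bladeM /blade_sign !big_set1 (symdiffC [set j]%SET).
have [->|] := eqVneq i j.
  rewrite ltnn expr0 scale1r (_ : symdiff _ _ = finset.set0) //.
  by apply/setP => k; rewrite !inE addbb.
rewrite -scalerDl mul0rn neq_ltn => /orP[] h; rewrite h ltnNge (ltnW h) /=.
  by rewrite subrr scale0r.
by rewrite addrC subrr scale0r.
Qed.

Definition pseudoscalar : clifford R n := \prod_(i < n) e_ i.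

Definition grade (k : nat) M : clifford R n :=
  [ffun A : {set 'I_n} => if #|A| == k then M A else 0].

Definition reverse M : clifford R n :=
  \sum_(k < n.+1) (-1) ^+ (k * k.-1)./2 *: grade k M.

Definition cl_even M := forall A : {set 'I_n}, odd #|A| -> M A = 0.
Definition cl_odd M := forall A : {set 'I_n}, ~~ odd #|A| -> M A = 0.

Definition cl_invertible M := exists N, M * N = 1 /\ N * M = 1.

Definition sqnorm M : R := \sum_A M A ^+ 2.

End Clifford.

Definition measure_matrix_display : measure_display -> measure_display.
Proof. exact. Qed.

Section MatrixMeasurable.
Context {d} {T : measurableType d}.
Variables m n : nat.

(* The product sigma-algebra; over R it is the Borel one. *)
Definition matrix_measurable : set (set 'M[T]_(m, n)) :=
  <<s \bigcup_(ij in [set: 'I_m * 'I_n])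
        preimage_set_system setT (fun X : 'M[T]_(m, n) => X ij.1 ij.2)
          measurable >>.

Let matrix_measurable0 : matrix_measurable set0.
Proof. exact: sigma_algebra0. Qed.

Let matrix_measurableC A : matrix_measurable A -> matrix_measurable (~` A).
Proof. exact: sigma_algebraC. Qed.

Let matrix_measurable_bigcup (F : (set 'M[T]_(m, n))^nat) :
  (forall i, matrix_measurable (F i)) -> matrix_measurable (\bigcup_i F i).
Proof. exact: sigma_algebra_bigcup. Qed.

HB.instance Definition _ := @isMeasurable.Build (measure_matrix_display d)
  'M[T]_(m, n) matrix_measurable
  matrix_measurable0 matrix_measurableC matrix_measurable_bigcup.

Lemma measurable_fun_matrixP d' (S : measurableType d') (f : S -> 'M[T]_(m, n)) :
  measurable_fun setT f <-> forall i j, measurable_fun setT (fun x => f x i j).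
Proof.
split=> [mf i j _ B mB|mf].
  rewrite setTI; pose C := (fun X : 'M[T]_(m, n) => X i j) @^-1` B.
  rewrite -[X in measurable X]setTI; apply: (mf _ C) => //.
  by apply: sub_sigma_algebra; exists (i, j) => //; exists B; rewrite ?setTI.
apply: (@measurability _ _ _ _ setT f _ erefl) => _ [_ [[i j] _ [B mB <-]] <-].
by rewrite !setTI; have := mf i j measurableT B mB; rewrite setTI.
Qed.

End MatrixMeasurable.

Section Lebesgue.
Variable R : realType.

Definition cons_cV n (p : R * 'cV[R]_n) : 'cV[R]_n.+1 :=
  col_mx (p.1)%:M p.2 : 'cV[R]_(1 + n).

Lemma measurable_cons_cV n : measurable_fun setT (@cons_cV n).
Proof.
apply/measurable_fun_matrixP => i j.
rewrite -(splitK (i : 'I_(1 + n))) ord1; case: (fintype.split _) => k /=.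
  rewrite (_ : (fun _ => _) = fst) //; apply/funext => p.
  by rewrite /cons_cV (@col_mxEu _ 1 n) ord1 mxE eqxx.
rewrite (_ : (fun _ => _) = (fun v : 'cV[R]_n => v k 0) \o snd); last first.
  by apply/funext => p; rewrite /cons_cV (@col_mxEd _ 1 n).
apply: measurableT_comp => //.
by have /measurable_fun_matrixP := @measurable_id _ 'cV[R]_n setT.
Qed.

(* Lebesgue measure on R x R^n, transported to R^n.+1. *)
Section Step.
Variables (n : nat) (mu : {measure set 'cV[R]_n -> \bar R}).

Definition lebesgue_step : set 'cV[R]_n.+1 -> \bar R :=
  pushforward (lebesgue_measure \x^ mu)%E (@cons_cV n).

Let lebesgue_step0 : lebesgue_step set0 = 0%E.
Proof. by rewrite /lebesgue_step /pushforward preimage_set0 measure0. Qed.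

Let lebesgue_step_ge0 A : (0 <= lebesgue_step A)%E.
Proof. by rewrite /lebesgue_step /pushforward measure_ge0. Qed.

Let lebesgue_step_sigma_additive : semi_sigma_additive lebesgue_step.
Proof.
apply: (@measure_semi_sigma_additive _ _ _ (pushforward _ _)).
exact: measurable_cons_cV.
Qed.

HB.instance Definition _ := isMeasure.Build _ _ _ lebesgue_step
  lebesgue_step0 lebesgue_step_ge0 lebesgue_step_sigma_additive.

End Step.

Fixpoint lebesgue_cV (n : nat) : {measure set 'cV[R]_n -> \bar R} :=
  match n with
  | 0 => \d_ (0 : 'cV[R]_0)
  | n'.+1 => lebesgue_step (lebesgue_cV n')
  end.

End Lebesgue.

Lemma lebesgue_cV_box (R : realType) n (A : 'I_n -> set R) :
  (forall i, measurable (A i)) ->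
  lebesgue_cV R n [set x | forall i, A i (x i 0)] =
  (\prod_(i < n) lebesgue_measure (A i))%E.
Proof.
elim: n A => [|n IH] A mA.
  by rewrite big_ord0 /= diracE mem_set //= => -[].
rewrite big_ord_recl -IH //=.
have lift0E (k : 'I_n) : lift ord0 k = rshift 1 k by apply/val_inj.
have ord0E : ord0 = lshift n (ord0 : 'I_1) by apply/val_inj.
rewrite /lebesgue_step /pushforward -product_measure2E //; last first.
- rewrite [X in measurable X](_ : _ =
      \bigcap_(k in [set` iota 0 n])
         (if insub k is Some i
          then (fun x : 'cV[R]_n => x i 0) @^-1` A (lift ord0 i) else setT)).
    apply: fin_bigcap_measurable => // k _; case: insubP => // i _ _.
    rewrite -[X in measurable X]setTI.
    have /measurable_fun_matrixP mid := @measurable_id _ 'cV[R]_n setT.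
    by apply: mid.
  apply/seteqP; split => x /= Ax.
    by move=> k _; case: insubP => // i _ _; exact: Ax.
  by move=> i; have := Ax i; rewrite valK; apply; rewrite /= mem_iota /=.
- exact: mA.
congr (product_measure2 _ _ _); apply/seteqP; split => -[x v] /=.
  move=> Ax; split.
    by have := Ax ord0; rewrite /cons_cV /= ord0E (@col_mxEu _ 1 n) mxE.
  move=> i; have := Ax (lift ord0 i).
  by rewrite /cons_cV /= lift0E (@col_mxEd _ 1 n).
move=> [Ax Av] i; rewrite /cons_cV /=.
case: (unliftP ord0 i) => [k|] ->.
  by have := Av k; rewrite lift0E (@col_mxEd _ 1 n).
by rewrite {2}ord0E (@col_mxEu _ 1 n) mxE.
Qed.

Section Integral.
Context {d} {T : measurableType d} {R : realType} {n : nat}.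
Variables (mu : {measure set T -> \bar R}) (D : set T) (F : T -> clifford R n).

Definition cl_integrable := forall A, mu.-integrable D (fun x => (F x A)%:E).

Definition cl_integral : clifford R n := [ffun A => \int[mu]_(x in D) F x A].

End Integral.

Section Fourier.
Context {R : realType} {n : nat}.
Implicit Types (f g : 'cV[R]_n -> clifford R n) (x w b : 'cV[R]_n).

Definition cl_measurable f := forall A, measurable_fun setT (fun x => f x A).

Definition L1 f := cl_integrable (lebesgue_cV R n) setT f.

(* The square of the L^2 norm. *)
Definition sqL2 f : \bar R := (\int[lebesgue_cV R n]_x (sqnorm (f x))%:E)%E.

Definition L2 f := cl_measurable f /\ (sqL2 f < +oo)%E.

Definition dotp w x : R := \sum_(i < n) w i 0 * x i 0.

Definition cl_exp (M : clifford R n) : clifford R n :=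
  [ffun A => limn (series (fun k => (k`!%:R^-1 *: M ^+ k) A : R))].

Definition cft f w : clifford R n :=
  cl_integral (lebesgue_cV R n) setT
    (fun x => f x * cl_exp (- (dotp w x *: pseudoscalar R n))).

Definition cvg_L2 (f_ : nat -> 'cV[R]_n -> clifford R n) f :=
  sqL2 (fun x => f_ k x - f x) @[k --> \oo] --> (0 : \bar R).

(* g is (a representative of) the Clifford Fourier transform of f, the latter
   being extended from L^1 `&` L^2 to L^2 by continuity. *)
Definition is_cft f g :=
  [/\ L2 f, L2 g & exists f_ : nat -> 'cV[R]_n -> clifford R n,
    [/\ forall k, L1 (f_ k) /\ L2 (f_ k), cvg_L2 f_ f
      & cvg_L2 (fun k => cft (f_ k)) g]].

End Fourier.

Section Wavelet.
Context {R : realType} {n : nat}.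
Implicit Types (psi f : 'cV[R]_n -> clifford R n) (r : 'M[R]_n) (w b x : 'cV[R]_n).

Definition SO : set 'M[R]_n := [set r | r *m r^T = 1%:M /\ \det r = 1].

(* The normalized Haar measure on the compact group SO(n), seen as a measure
   on n x n matrices carried by SO(n); these properties determine it. *)
Definition is_haar (haar : probability 'M[R]_n R) :=
  haar SO = 1%E /\
  forall r (X : set 'M[R]_n), SO r -> measurable X -> X `<=` SO ->
    haar [set r *m s | s in X] = haar X.

Definition admissibility_integrand (psihat : 'cV[R]_n -> clifford R n) w
    (p : R * 'M[R]_n) : clifford R n :=
  let: (a, r) := p in
  let M := psihat (a *: (invmx r *m w)) in
  (a ^+ n * a ^- n.+1) *: (reverse M * M).

(* C is the constant C_psi; that it does not depend on w is part of
   admissibility. *)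
Definition admissible (haar : probability 'M[R]_n R) psi :=
  [/\ L2 psi,
      exists2 psihat, is_cft psi psihat &
        exists2 C, cl_invertible C &
          {ae lebesgue_cV R n, forall w,
             cl_integrable (lebesgue_measure \x haar)%E (`]0, +oo[ `*` SO)
               (admissibility_integrand psihat w) /\
             cl_integral (lebesgue_measure \x haar)%E (`]0, +oo[ `*` SO)
               (admissibility_integrand psihat w) = C}
    & n = 2 %[mod 4] ->
        {ae lebesgue_cV R n, forall x, cl_even (psi x)} \/
        {ae lebesgue_cV R n, forall x, cl_odd (psi x)}].

Definition daughter psi (a : R) r b x : clifford R n :=
  a `^ (- (n%:R / 2)) *: psi (invmx r *m (a^-1 *: (x - b))).

Definition wavelet_transform psi f (a : R) r b : clifford R n :=
  cl_integral (lebesgue_cV R n) setT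
    (fun x => f x * reverse (daughter psi a r b x)).

End Wavelet.

(* Main.v *)
(* The substitution y = c x maps the daughter wavelet with parameters
   (a, r, b) to c^(n/2) times the one with parameters (c a, r, c b), while
   dx = c^(-n) dy; the two factors combine to c^(-n/2). The scaling of
   Lebesgue measure on R^n follows from that on R by slicing along the first
   coordinate. *)
Require Import Defs.
From HB Require Import structures.
From mathcomp Require Import all_boot all_order all_algebra.
From mathcomp Require Import all_classical all_reals all_analysis.
From mathcomp Require Import measurable_realfun.

Import Order.TTheory GRing.Theory Num.Theory.
Import numFieldNormedType.Exports.

Local Open Scope classical_set_scope.
Local Open Scope ring_scope.

Section ScaledIntegral.
Context d (T : measurableType d) (R : realType).
Variables (mu : {measure set T -> \bar R}).
Local Open Scope ereal_scope.

(* With [+oo - +oo = -oo] this holds for all extended reals, so that positive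
   constants can be pulled out of integrals of non-integrable functions. *)
Lemma gt0_muleB (k : R) (x y : \bar R) : (0 < k)%R ->
  k%:E * x - k%:E * y = k%:E * (x - y).
Proof.
move=> k0; case: x => [x||]; case: y => [y||] //=;
  rewrite ?gt0_muley ?gt0_muleNy ?lte_fin //.
by congr EFin; rewrite mulrBr.
Qed.

(** A positive factor fixes each infinity and [fine] sends both to 0, so the two sides agree there
    as well. *)
Lemma gt0_fineMl (k : R) (x : \bar R) : (0 < k)%R ->
  fine (k%:E * x) = (k * fine x)%R.
Proof.
by move=> k0; case: x => [x||] //=;
  rewrite ?gt0_muley ?gt0_muleNy ?lte_fin//= mulr0.
Qed.

(** Positive and negative parts scale separately, and [gt0_muleB] recombines them even when both
    integrals are infinite. Measurability of the wavelet integrands is then enough to extract their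
    constants. *)
Lemma gt0_integralZl (k : R) (f : T -> \bar R) : (0 < k)%R ->
  measurable_fun [set: T] f ->
  \int[mu]_x (k%:E * f x) = k%:E * \int[mu]_x f x.
Proof.
move=> k0 mf; rewrite integralE [in RHS]integralE -gt0_muleB//.
rewrite ge0_funeposM ?ge0_funenegM ?(ltW k0)// !ge0_integralZl ?lee_fin ?ltW//.
- exact: measurable_funeneg.
- exact: measurable_funepos.
Qed.

Lemma gt0_RintegralZl (k : R) (f : T -> R) : (0 < k)%R ->
  measurable_fun [set: T] f ->
  (\int[mu]_x (k * f x) = k * \int[mu]_x f x)%R.
Proof.
move=> k0 mf; rewrite /Rintegral -gt0_fineMl// -gt0_integralZl//.
exact/measurable_EFinP.
Qed.

Variables (phi : T -> T) (k : R).
Hypotheses (mphi : measurable_fun [set: T] phi) (k0 : (0 < k)%R).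
Hypothesis mu_phi : forall A, measurable A -> mu (phi @^-1` A) = k%:E * mu A.

(** By [mu_phi], the pushforward of [mu] along [phi] is the measure [k] times [mu]; integrating [f]
    against both gives the two sides. *)
Lemma ge0_integral_comp_scaled (f : T -> \bar R) :
  measurable_fun [set: T] f -> (forall x, 0 <= f x) ->
  \int[mu]_x f (phi x) = k%:E * \int[mu]_x f x.
Proof.
move=> mf f0; pose K := NngNum (ltW k0).
rewrite -[k]/(K%:num)%R -ge0_integral_mscale//.
rewrite -[LHS](@ge0_integral_pushforward _ _ _ _ _ phi mphi mu setT)//.
by apply: eq_measure_integral => A mA _; exact: mu_phi.
Qed.

(** Taking positive and negative parts commutes with composition by [phi], which reduces this to the
    nonnegative case. *)
Lemma integral_comp_scaled (f : T -> \bar R) :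
  measurable_fun [set: T] f -> \int[mu]_x f (phi x) = k%:E * \int[mu]_x f x.
Proof.
move=> mf; rewrite integralE [in RHS]integralE -gt0_muleB//.
rewrite -!ge0_integral_comp_scaled//.
- by congr (_ - _); apply: eq_integral => x _;
    rewrite ?(funepos_comp f phi) ?(funeneg_comp f phi).
- exact: measurable_funeneg.
- exact: measurable_funepos.
Qed.

End ScaledIntegral.

Section Dilation.
Context {R : realType}.
Variable c : R.
Hypothesis c0 : 0 < c.

(** Uniqueness of Lebesgue measure: [c] times its pushforward under the dilation gives each interval
    []a, b]] its length. *)
Lemma lebesgue_measure_dilation (A : set R) : measurable A ->
  (lebesgue_measure ((fun x => c * x)%R @^-1` A) = c^-1%:E * lebesgue_measure A)%E.
Proof.
move=> mA.
have mc : measurable_fun setT (fun x : measurableTypeR R => c * x : measurableTypeR R).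
  exact: measurable_funM.
(* The pushforward is a measure only for a measurable map; [nu] takes that proof as an argument,
   hence [nu mc] below. *)
pose nu : {measure set (measurableTypeR R) -> \bar R} :=
  mscale (NngNum (ltW c0)) (pushforward lebesgue_measure
    (fun x : measurableTypeR R => c * x : measurableTypeR R)).
suff -> : lebesgue_measure A = nu mc A.
  by rewrite /nu /= /mscale /pushforward /= muleA -EFinM mulVf ?gt_eqF// mul1e.
apply: lebesgue_measure_unique => //= _ [[a b]] _ <-.
have preimE : (fun x => c * x) @^-1` `]a, b] = `]a / c, b / c]%classic.
  apply/seteqP; split => x /=; rewrite !in_itv /=;
  by rewrite ltr_pdivrMr// ler_pdivlMr// ![x * c]mulrC.
change (lebesgue_measure `]a, b] =
  c%:E * lebesgue_measure ((fun x => c * x)%R @^-1` `]a, b]%classic))%E.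
rewrite preimE !lebesgue_measure_itv/= !lte_fin ltr_pM2r ?invr_gt0//.
case: ifPn => _; last by rewrite mule0.
by rewrite -!EFinB -EFinM -mulrBl mulrCA divff ?gt_eqF// mulr1.
Qed.

Lemma measurable_dilation n : measurable_fun setT (fun x : 'cV[R]_n => c *: x).
Proof.
apply/measurable_fun_matrixP => i j.
have /measurable_fun_matrixP mid := @measurable_id _ 'cV[R]_n setT.
under eq_fun do rewrite mxE.
exact: measurable_funM (measurable_cst _) (mid i j).
Qed.

Lemma cons_cVZ n (p : R * 'cV[R]_n) :
  c *: cons_cV p = cons_cV (c * p.1, c *: p.2).
Proof.
rewrite /cons_cV -scale_scalar_mx.
exact: (@scale_col_mx _ 1 n 1 c p.1%:M p.2).
Qed.

Lemma lebesgue_cV_dilation n (A : set 'cV[R]_n) : measurable A ->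
  (lebesgue_cV R n ((fun x => c *: x) @^-1` A)
    = (c ^- n)%:E * lebesgue_cV R n A)%E.
Proof.
elim: n A => [|n IH] A mA.
  (* In dimension 0 the measure is the Dirac mass at 0, a point fixed by the dilation. *)
  rewrite expr0 invr1 mul1e /= !diracE; congr (_ _)%:E.
  by congr nat_of_bool; apply/idP/idP; rewrite !inE /= scaler0.
rewrite /= /lebesgue_step /pushforward /=.
set B := (@cons_cV R n) @^-1` A.
have mB : measurable B.
  by rewrite -[B]setTI; exact: measurable_cons_cV.
have mS : measurable_fun setT (lebesgue_measure \o ysection B : 'cV[R]_n -> \bar R).
  exact: measurable_fun_ysection.
rewrite /product_measure2.
(* The slice at [v] of the dilated preimage is the preimage under [c * x] of the slice of [B] at
   [c *: v]; the one-dimensional case yields the factor [c^-1]. *)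
transitivity (\int[lebesgue_cV R n]_v
    (c^-1%:E * (lebesgue_measure \o ysection B) (c *: v)))%E.
  apply: eq_integral => v _ /=.
  rewrite -lebesgue_measure_dilation; last exact: measurable_ysection.
  congr (lebesgue_measure _); apply/seteqP.
  by split => x; rewrite /ysection /B /= !inE /= cons_cVZ.
have c'0 : 0 < c^-1 by rewrite invr_gt0.
rewrite gt0_integralZl//; last first.
  by apply: (measurableT_comp mS); exact: measurable_dilation.
(* The induction hypothesis serves as [mu_phi] for the substitution in the remaining [n]
   coordinates. *)
rewrite (@ge0_integral_comp_scaled _ _ _ (lebesgue_cV R n) (fun v => c *: v) (c ^- n))//.
- by rewrite muleA -EFinM -invfM -exprS.
- exact: measurable_dilation.
- by rewrite invr_gt0 exprn_gt0.
Qed.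

Lemma Rintegral_dilation n (f : 'cV[R]_n -> R) : measurable_fun setT f ->
  \int[lebesgue_cV R n]_x f (c *: x) = c ^- n * \int[lebesgue_cV R n]_x f x.
Proof.
move=> mf; rewrite /Rintegral.
rewrite (@integral_comp_scaled _ _ _ (lebesgue_cV R n) (fun v => c *: v) (c ^- n)
  _ _ _ (EFin \o f)).
- by rewrite gt0_fineMl// invr_gt0 exprn_gt0.
- exact: measurable_dilation.
- by rewrite invr_gt0 exprn_gt0.
- exact: lebesgue_cV_dilation.
- exact/measurable_EFinP.
Qed.

End Dilation.

Section CliffordMeasurable.
Context {R : realType} {n : nat}.
Implicit Types (F G : 'cV[R]_n -> clifford R n) (M N : clifford R n).

Lemma reverseZ (k : R) M : reverse (k *: M) = k *: reverse M.
Proof.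
rewrite /reverse scaler_sumr; apply: eq_bigr => j _.
rewrite scalerA [k * _]mulrC -scalerA; congr (_ *: _).
by apply/ffunP => A; rewrite !ffunE; case: ifP => // _; rewrite scaler0.
Qed.

Lemma cl_measurable_mul F G : cl_measurable F -> cl_measurable G ->
  cl_measurable (fun x => F x * G x).
Proof.
move=> mF mG A; under eq_fun do rewrite clmulE.
apply: measurable_sum => B; apply: measurable_funM; last exact: mG.
exact: measurable_funM.
Qed.

Lemma cl_measurable_reverse F : cl_measurable F ->
  cl_measurable (fun x => reverse (F x)).
Proof.
move=> mF A; rewrite /reverse.
under eq_fun do rewrite sum_ffunE.
apply: measurable_sum => k.
under eq_fun do rewrite !ffunE.
apply: measurable_funM => //; case: (#|A| == k) => //; exact: mF.
Qed.

Lemma measurable_affine (M : 'M[R]_n) (k : R) (b : 'cV[R]_n) :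
  measurable_fun setT (fun x : 'cV[R]_n => M *m (k *: (x - b))).
Proof.
apply/measurable_fun_matrixP => i j.
have /measurable_fun_matrixP mid := @measurable_id _ 'cV[R]_n setT.
under eq_fun do rewrite mxE.
apply: measurable_sum => l; under eq_fun do rewrite !mxE.
do 2 apply: measurable_funM => //.
exact: measurable_funB.
Qed.

End CliffordMeasurable.

Theorem mainTheorem7 (R : realType) (n : nat)
    (hn : n = 2 %[mod 4] \/ n = 3 %[mod 4])
    (haar : probability 'M[R]_n R) (hhaar : is_haar haar)
    (psi f : 'cV[R]_n -> clifford R n) (hpsi : admissible haar psi) (hf : L2 f)
    (c : R) (hc : 0 < c)
    (a : R) (ha : 0 < a) (r : 'M[R]_n) (hr : SO r) (b : 'cV[R]_n) :
  wavelet_transform psi (fun x => f (c *: x)) a r b =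
  (c `^ (n%:R / 2))^-1 *: wavelet_transform psi f (c * a) r (c *: b).
Proof.
have [mf _] := hf; have [[mpsi _] _ _] := hpsi.
(* [g] is the daughter wavelet at [(c * a, r, c *: b)] without its normalizing power; up to
   constants, both integrands are [h], taken at [c *: x] on the left and at [x] on the right. *)
pose g y := psi (invmx r *m ((c * a)^-1 *: (y - c *: b))).
pose h y := f y * reverse (g y).
have mh : cl_measurable h.
  apply: cl_measurable_mul => //; apply: cl_measurable_reverse => A.
  by apply: (measurableT_comp (mpsi A)); exact: measurable_affine.
(* This rests on [(x - b) / a = (c x - c b) / (c a)]. *)
have lhsE x : f (c *: x) * reverse (daughter psi a r b x) =
    a `^ (- (n%:R / 2)) *: h (c *: x).
  rewrite /daughter reverseZ -scalerAr /h /g -scalerBr scalerA invfM.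
  by rewrite mulrAC mulVf ?gt_eqF// mul1r.
have rhsE x : f x * reverse (daughter psi (c * a) r (c *: b) x) =
    (c * a) `^ (- (n%:R / 2)) *: h x.
  by rewrite /daughter reverseZ -scalerAr.
apply/ffunP => A; rewrite !ffunE.
under eq_Rintegral => x _ do rewrite lhsE ffunE.
under [in RHS]eq_Rintegral => x _ do rewrite rhsE ffunE.
rewrite /= !gt0_RintegralZl ?powR_gt0 ?mulr_gt0//; last first.
  by apply: (measurableT_comp (mh A)); exact: measurable_dilation.
rewrite (Rintegral_dilation _ hc _ _ (mh A)).
(* Only the constants remain: [a^(-n/2) c^(-n) = c^(-n/2) (c a)^(-n/2)]. *)
rewrite /GRing.scale /= !mulrA; congr (_ * _).
rewrite powRM ?ltW// mulrCA mulrA mulrC; congr (_ * _).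
rewrite powRN -invfM -powRD ?(gt_eqF hc) ?implybT//.
by rewrite -splitr powR_mulrn ?ltW.
Qed.
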